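(* Let $s > r \geq 3$ be integers. There is a constant $n_{s,r}$ such that for all $n \geq n_{s,r}$, $$\max\left\{ \frac{\binom{s-2}{r-1}}{r-1}\, n - 2\binom{s-2}{r-1},\ \left(\frac{\binom{s-2}{r-1}+\binom{s-3}{r-2}}{r}\right) n \right\} \leq \mathrm{sat}(n,K_r,K_s) \leq (n-s+2)\binom{s-2}{r-1} + \binom{s-2}{r}.$$
   Context: All graphs are finite and simple. A graph $G$ is $F$-free if it contains no (not necessarily induced) subgraph isomorphic to $F$. $G$ is $F$-saturated if $G$ is $F$-free but adding any nonedge to $G$ creates at least one copy of $F$. A copy of $H$ in $G$ is a (not necessarily induced) subgraph of $G$ isomorphic to $H$. $\mathrm{sat}(n,H,F)$ denotes the minimum number of copies of $H$ in an $n$-vertex $F$-saturated graph. $K_m$ is the complete graph on $m$ vertices. *)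

(* Defs.v *)
From HB Require Import structures.
From mathcomp Require Import all_boot all_order all_algebra.

Set Implicit Arguments.
Unset Strict Implicit.
Unset Printing Implicit Defensive.

(* A simple graph on T is given by its edge set, a set of 2-element subsets
   of T. *)
Definition simple_edges (T : finType) (E : {set {set T}}) : bool :=
  [forall e in E, #|e| == 2].

Record sgraph (T : finType) :=
  SGraph { edges : {set {set T}}; edgesP : simple_edges edges }.

HB.instance Definition _ (T : finType) := [isSub for @edges T].
HB.instance Definition _ (T : finType) := [Finite of sgraph T by <:].

Lemma simple_filter (T : finType) (E : {set {set T}}) :
  simple_edges [set e in E | #|e| == 2].
Proof. by apply/forall_inP => e; rewrite inE => /andP[]. Qed.

Definition graph_of (T : finType) (E : {set {set T}}) : sgraph T :=
  SGraph (simple_filter E).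

Definition complete (m : nat) : sgraph 'I_m := graph_of [set: {set 'I_m}].

Definition add_edge (T : finType) (G : sgraph T) (x y : T) : sgraph T :=
  graph_of ([set x; y] |: edges G).

(* A pair S = (vertex set, edge set) that is a, not necessarily induced or
   spanning, subgraph of G. *)
Definition subgraph (T : finType) (G : sgraph T)
    (S : {set T} * {set {set T}}) : bool :=
  (S.2 \subset edges G) && [forall e in S.2, e \subset S.1].

Definition isomorphic_to (U T : finType) (H : sgraph U)
    (S : {set T} * {set {set T}}) : bool :=
  [exists f : {ffun U -> T},
    [&& injectiveb f, f @: [set: U] == S.1
      & [set f @: (e : {set U}) | e in edges H] == S.2]].

Definition copies (U T : finType) (H : sgraph U) (G : sgraph T) :
    {set {set T} * {set {set T}}} :=
  [set S | subgraph G S && isomorphic_to H S].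

Definition free (U T : finType) (F : sgraph U) (G : sgraph T) : bool :=
  copies F G == set0.

Definition saturated (U T : finType) (F : sgraph U) (G : sgraph T) : bool :=
  free F G &&
  [forall x, forall y,
    (x != y) && ([set x; y] \notin edges G) ==> ~~ free F (add_edge G x y)].

(* The value 0 when no F-saturated graph exists on n vertices is a convention;
   by saturated_exists it is never used when F has an edge. *)
Definition sat (n : nat) (U W : finType) (H : sgraph U) (F : sgraph W) : nat :=
  if [pick G : sgraph 'I_n | saturated F G] is Some G0 then
    #|copies H [arg min_(G < G0 | saturated F G) #|copies H G|]|
  else 0.

Lemma satP (n : nat) (U W : finType) (H : sgraph U) (F : sgraph W) :
  (exists G : sgraph 'I_n, saturated F G) ->
  (exists2 G : sgraph 'I_n, saturated F G & #|copies H G| = sat n H F) /\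
  (forall G : sgraph 'I_n, saturated F G -> sat n H F <= #|copies H G|).
Proof.
move=> [G1 sG1]; rewrite /sat; case: pickP => [G0 sG0|/(_ G1)]; last by rewrite sG1.
by case: arg_minnP => // G sG minG; split=> //; exists G.
Qed.

Lemma saturated_exists (n : nat) (W : finType) (F : sgraph W) :
  edges F != set0 -> exists G : sgraph 'I_n, saturated F G.
Proof.
move=> /set0Pn[e eF].
have free0 : free F (graph_of (set0 : {set {set 'I_n}})).
  apply/eqP/setP => S; rewrite !inE; apply/negbTE/negP.
  case/andP=> /andP[/subsetP sub _] /existsP[f /and3P[_ _ /eqP defS]].
  have: f @: e \in S.2 by rewrite -defS; apply/imsetP; exists e.
  by move/sub; rewrite !inE.
case: (arg_maxnP (fun G : sgraph 'I_n => #|edges G|) free0) => G fG maxG.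
exists G; rewrite /saturated fG /=.
apply/forallP => x; apply/forallP => y; apply/implyP => /andP[nxy nG].
apply/negP => /maxG; apply/negP; rewrite -ltnNge proper_card //.
apply/properP; split; last by exists [set x; y]; rewrite // !inE eqxx cards2 nxy.
apply/subsetP => e' e'G; rewrite !inE e'G orbT /=.
exact: (forall_inP (edgesP G)).
Qed.

(* Main.v *)
Require Import Defs.
From mathcomp Require Import all_boot all_order all_algebra.
From mathcomp Require Import zify ring lra.
Import Order.TTheory GRing.Theory Num.Theory.

(** Write C for 'C(s - 2, r - 1) and t for the number of r-cliques of a
    K_s-saturated graph G on n vertices.

    Upper bound: joining a clique on s - 2 vertices to an independent set on
    the other vertices gives a K_s-saturated graph ([split_graph_saturated]);
    each of its r-cliques has at most one vertex outside the core, which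
    gives the count ([card_cliques_split_graph]).

    Lower bound: both terms of the maximum are at most (2/3) C n, because
    r >= 3 and 'C(s - 3, r - 2) <= C by the Pascal rule. So it is enough that
    3 t >= 2 C n once n is large ([saturated_cliques_lower]). Two nonadjacent
    vertices of G have a clique A of s - 2 vertices in their common
    neighbourhood, since joining them creates a K_s
    ([saturated_common_clique]). Fix a threshold D that depends only on s and
    r, and call a vertex light if it lies in fewer than D of the r-cliques.

    Each heavy vertex lies in at least D of the r-cliques, so r t is at least
    D times the number of heavy vertices: if D is large compared with C, heavy
    vertices more than pay for themselves ([card_heavy]).

    Let K be a maximal clique of light vertices, and let S be K together with
    all r-cliques through vertices of K. As K has fewer than s vertices, the
    size of S is bounded in terms of s, r and D only ([card_hub]). A light
    vertex z outside S is nonadjacent to some x in K, so x and z have a common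
    clique A on s - 2 vertices. As r - 1 <= s - 2, every vertex of A lies in
    an r-clique with x, hence A is inside S ([common_clique_sub_hub]). The C
    cliques formed by z and r - 1 vertices of A meet the complement of S in z
    alone, so different z give different cliques: t is at least C times the
    number of light vertices, up to a constant ([light_bound]). *)

(** * Copies of complete graphs as cliques *)

Definition adj {T : finType} (G : sgraph T) (x y : T) : bool :=
  [set x; y] \in edges G.

Definition clique {T : finType} (G : sgraph T) (A : {set T}) : bool :=
  [forall x in A, forall y in A, (x != y) ==> adj G x y].

Definition cliques {T : finType} (m : nat) (G : sgraph T) : {set {set T}} :=
  [set A : {set T} | (#|A| == m) && clique G A].

(** The edge set of the complete graph on A. *)
Definition pairs_in {T : finType} (A : {set T}) : {set {set T}} :=
  [set e : {set T} | (e \subset A) && (#|e| == 2)].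

Lemma cliqueP {T : finType} {G : sgraph T} {A : {set T}} :
  reflect {in A &, forall x y, x != y -> adj G x y} (clique G A).
Proof.
apply: (iffP forall_inP) => [cA x y xA yA nxy | cA x xA].
  by have /forall_inP/(_ y yA)/implyP := cA x xA; apply.
by apply/forall_inP => y yA; apply/implyP; apply: cA.
Qed.

Lemma clique_sub {T : finType} {G : sgraph T} {A B : {set T}} :
  A \subset B -> clique G B -> clique G A.
Proof. by move=> /subsetP AB /cliqueP cB; apply/cliqueP => x y /AB ? /AB; apply: cB. Qed.

Lemma adj_sym {T : finType} (G : sgraph T) x y : adj G x y = adj G y x.
Proof. by rewrite /adj setUC. Qed.

Lemma adj_neq {T : finType} {G : sgraph T} {x y} : adj G x y -> x != y.
Proof.
by move=> Gxy; have := forall_inP (edgesP G) _ Gxy; rewrite cards2; case: (x != y).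
Qed.

Lemma adj_add_edge {T : finType} (G : sgraph T) x y u v :
  adj (add_edge G x y) u v =
  (u != v) && (([set u; v] == [set x; y]) || adj G u v).
Proof. by rewrite /adj !inE cards2 andbC; case: (u != v). Qed.

Lemma imset_edges_complete {T : finType} (m : nat) (f : 'I_m -> T) :
  injective f ->
  [set f @: (e : {set 'I_m}) | e in edges (complete m)]
    = pairs_in (f @: [set: 'I_m]).
Proof.
move=> injf; apply/setP => e; rewrite inE; apply/imsetP/andP.
  case=> d; rewrite !inE /= => d2 ->.
  by rewrite card_imset // imsetS ?subsetT.
(* A pair inside the range of f is the image of its own preimage. *)
case=> /subsetP efT e2; have defe : e = f @: (f @^-1: e).
  apply/setP => z; apply/idP/imsetP => [ze|[i]]; last by rewrite inE => ? ->.
  by have /imsetP[i _ zi] := efT z ze; exists i; rewrite // inE -zi.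
by exists (f @^-1: e); rewrite // !inE /= -(card_imset _ injf) -defe.
Qed.

(** A copy of a complete graph is determined by its vertex set, so counting
    copies amounts to counting cliques. *)
Lemma copies_complete {T : finType} (m : nat) (G : sgraph T) :
  copies (complete m) G = [set (A, pairs_in A) | A in cliques m G].
Proof.
apply/setP => [[A E]]; rewrite inE; apply/andP/imsetP => /=.
  case=> /andP[/= /subsetP EG _].
  case/existsP=> f /and3P[/injectiveP injf /eqP/= fA /eqP/= fE].
  have defE : E = pairs_in A by rewrite -fE -fA imset_edges_complete.
  exists A; rewrite ?defE // inE -fA card_imset // cardsT card_ord eqxx /=.
  apply/cliqueP => x y xA yA nxy; apply: EG.
  by rewrite defE !inE subUset !sub1set -fA xA yA cards2 nxy.
case=> B; rewrite inE => /andP[/eqP cardB /cliqueP cB] [-> ->]; split.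
  apply/andP; split; last by apply/forall_inP => e; rewrite inE => /andP[].
  apply/subsetP => e; rewrite inE => /andP[eB /cards2P[x [y [nxy defe]]]].
  by move: eB; rewrite defe subUset !sub1set => /andP[] *; apply: cB.
pose f := [ffun i : 'I_m => enum_val (cast_ord (esym cardB) i)].
have injf : injective f.
  by move=> i j; rewrite !ffunE => /enum_val_inj/cast_ord_inj.
have fT : f @: [set: 'I_m] = B.
  apply/eqP; rewrite eqEcard card_imset // cardsT card_ord cardB leqnn andbT.
  by apply/subsetP => _ /imsetP[i _ ->]; rewrite ffunE enum_valP.
apply/existsP; exists f; apply/and3P; split=> /=; first exact/injectiveP.
  by rewrite fT.
by rewrite imset_edges_complete ?fT.
Qed.

Lemma card_copies_complete {T : finType} (m : nat) (G : sgraph T) :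
  #|copies (complete m) G| = #|cliques m G|.
Proof. by rewrite copies_complete card_imset // => A B []. Qed.

Lemma free_completeE {T : finType} (m : nat) (G : sgraph T) :
  Defs.free (complete m) G = (cliques m G == set0).
Proof. by rewrite /Defs.free -!cards_eq0 card_copies_complete. Qed.

Lemma subset_of_card {T : finType} {m : nat} {A : {set T}} :
  m <= #|A| -> exists2 B : {set T}, B \subset A & #|B| = m.
Proof.
rewrite -bin_gt0 -cards_draws => /card_gt0P[B].
by rewrite inE => /andP[BA /eqP]; exists B.
Qed.

(** Any larger clique would contain one with exactly s vertices. *)
Lemma clique_card_lt {T : finType} {s : nat} {G : sgraph T} {A : {set T}} :
  Defs.free (complete s) G -> clique G A -> #|A| < s.
Proof.
rewrite free_completeE => /eqP noK cA; rewrite ltnNge; apply/negP.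
case/subset_of_card => B BA cardB; have: B \in cliques s G.
  by rewrite inE cardB eqxx (clique_sub BA).
by rewrite noK inE.
Qed.

Lemma cliqueU1 {T : finType} {G : sgraph T} {z} {A : {set T}} :
  clique G A -> {in A, forall a, adj G z a} -> clique G (z |: A).
Proof.
move=> /cliqueP cA zA; apply/cliqueP => x y /setU1P[->|xA] /setU1P[->|yA] nxy.
- by rewrite eqxx in nxy.
- exact: zA.
- by rewrite adj_sym zA.
- exact: cA.
Qed.

(** * Common cliques of nonadjacent vertices *)

(** Joining x to y creates a clique on s vertices; it must use the new edge,
    and without x and y it is the required clique A. *)
Lemma saturated_common_clique {T : finType} {s : nat} {G : sgraph T} {x y : T} :
  saturated (complete s) G -> x != y -> ~~ adj G x y ->
  exists A : {set T}, [/\ #|A| = s - 2, clique G A,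
    {in A, forall a, adj G x a} & {in A, forall a, adj G y a}].
Proof.
case/andP=> free_G /forallP/(_ x)/forallP/(_ y)/implyP sat_xy nxy nGxy.
have := sat_xy; rewrite nxy nGxy => /(_ isT).
rewrite free_completeE => /set0Pn[Q]; rewrite inE => /andP[/eqP cardQ /cliqueP cQ].
have adjQ u v : u \in Q -> v \in Q -> u != v -> [set u; v] != [set x; y] -> adj G u v.
  move=> uQ vQ nuv /negPf neq; have := cQ u v uQ vQ nuv.
  by rewrite adj_add_edge nuv neq.
have xyQ : [set x; y] \subset Q.
  case: (boolP (_ \subset _)) => // nsub.
  have cGQ : clique G Q.
    apply/cliqueP => u v uQ vQ nuv; apply: adjQ => //.
    by apply: contraNneq nsub => <-; rewrite subUset !sub1set uQ.
  by have := clique_card_lt free_G cGQ; rewrite cardQ ltnn.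
have [xQ yQ] : x \in Q /\ y \in Q by apply/andP; rewrite -!sub1set -subUset.
exists (Q :\: [set x; y]); split.
- by rewrite cardsD (setIidPr xyQ) cardQ cards2 nxy.
- apply/cliqueP => u v; rewrite !inE !negb_or.
  move=> /andP[/andP[ux uy] uQ] /andP[_ vQ] nuv; apply: adjQ => //.
  apply: contraTneq (set21 u v) => ->; rewrite !inE negb_or; exact/andP.
- move=> a; rewrite !inE negb_or => /andP[/andP[ax ay] aQ].
  apply: adjQ => //; first by rewrite eq_sym.
  by apply: contraTneq (set22 x a) => ->; rewrite !inE negb_or; apply/andP.
- move=> a; rewrite !inE negb_or => /andP[/andP[ax ay] aQ].
  apply: adjQ => //; first by rewrite eq_sym.
  by apply: contraTneq (set22 y a) => ->; rewrite !inE negb_or; apply/andP.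
Qed.

(** * The lower bound *)

(** The cardinal of [star r G x] measures how heavy x is. *)
Definition star {T : finType} (r : nat) (G : sgraph T) (x : T) : {set {set T}} :=
  [set Q in cliques r G | x \in Q].

Lemma sum_card_star {T : finType} (r : nat) (G : sgraph T) :
  \sum_x #|star r G x| = r * #|cliques r G|.
Proof.
under eq_bigr do rewrite -sum1_card.
under eq_bigr do under eq_bigl do rewrite inE.
rewrite (exchange_big_dep (mem (cliques r G))) /=; last by move=> x Q _ /andP[].
rewrite mulnC -sum_nat_const; apply: eq_bigr => Q QG.
under eq_bigl do rewrite QG.
by rewrite sum1_card; move: QG; rewrite inE => /andP[/eqP].
Qed.

Lemma card_heavy {T : finType} (r D : nat) (G : sgraph T) :
  D * #|[set x | D <= #|star r G x|]| <= r * #|cliques r G|.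
Proof.
rewrite -sum_card_star mulnC -sum_nat_const.
rewrite [leqRHS](bigID (mem [set x | D <= #|star r G x|])) /=.
by apply: leq_trans (leq_addr _ _); apply: leq_sum => x; rewrite inE.
Qed.

Lemma card_bigcup_leq {I T : finType} (P : pred I) (F : I -> {set T}) :
  #|\bigcup_(i | P i) F i| <= \sum_(i | P i) #|F i|.
Proof.
elim/big_ind2: _ => [|A a B b Aa Bb|//]; first by rewrite cards0.
by rewrite (leq_trans (leq_card_setU _ _)) ?leq_add.
Qed.

(** K and all r-cliques through K: when the vertices of K are light, this set
    has bounded size, yet it contains every common clique of a vertex of K
    and a nonneighbour of it. *)
Definition hub {T : finType} (r : nat) (G : sgraph T) (K : {set T}) : {set T} :=
  K :|: \bigcup_(x in K) \bigcup_(Q in star r G x) Q.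

Lemma card_hub {T : finType} (r D : nat) (G : sgraph T) (K : {set T}) :
  {in K, forall x, #|star r G x| <= D} -> #|hub r G K| <= #|K| * (D * r).+1.
Proof.
move=> lightK; rewrite mulnS (leq_trans (leq_card_setU _ _)) // leq_add2l.
rewrite (leq_trans (card_bigcup_leq _ _)) // -sum_nat_const.
apply: leq_sum => x xK; rewrite (leq_trans (card_bigcup_leq _ _)) //.
rewrite (eq_bigr (fun=> r)) ?sum_nat_const ?leq_mul2r ?lightK ?orbT //.
by move=> Q; rewrite !inE => /andP[/andP[/eqP]].
Qed.

(** Each a in A completes to r - 1 vertices of A, which together with x form
    an r-clique through x. *)
Lemma common_clique_sub_hub {T : finType} {r : nat} {G : sgraph T}
    {K A : {set T}} {x : T} :
  1 < r -> r - 1 <= #|A| -> x \in K -> clique G A -> {in A, forall a, adj G x a} ->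
  A \subset hub r G K.
Proof.
move=> r1 rA xK cA xA; apply/subsetP => a aA.
have [|B BA cardB] := @subset_of_card _ (r - 2) (A :\ a).
  by rewrite (cardsD1 a) aA in rA; lia.
have [aB BsubA] : a \notin B /\ B \subset A.
  by move: BA; rewrite subsetD1 => /andP[].
have aBA : a |: B \subset A by rewrite subUset sub1set aA.
rewrite inE; apply/orP; right; apply/bigcupP; exists x => //.
have xaB : x \notin a |: B.
  by apply/negP => /(subsetP aBA)/xA/adj_neq; rewrite eqxx.
apply/bigcupP; exists (x |: (a |: B)); last by rewrite !inE eqxx orbT.
rewrite !inE eqxx cardsU1 xaB cardsU1 aB cardB /= andbT; apply/andP; split.
  by apply/eqP; lia.
apply: cliqueU1 => [|b /(subsetP aBA)]; [exact: clique_sub aBA cA | exact: xA].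
Qed.

(** Each set of r - 1 vertices of A forms an r-clique with z. Recording that
    these cliques leave S only at z is what keeps them apart for different
    z. *)
Lemma card_cliques_from {T : finType} {r : nat} {G : sgraph T}
    {S A : {set T}} {z : T} :
  0 < r -> z \notin S -> A \subset S -> clique G A -> {in A, forall a, adj G z a} ->
  'C(#|A|, r - 1) <= #|[set Q in cliques r G | Q :\: S == [set z]]|.
Proof.
move=> r0 zS AS cA zA; rewrite -cards_draws.
have inj : {in [set B : {set T} | B \subset A & #|B| == r - 1] &, injective (fun B => z |: B)}.
  (* Intersecting with S recovers B from z |: B. *)
  have K (B : {set T}) : B \subset A -> (z |: B) :&: S = B.
    move=> BA; rewrite setIUl (setIidPl (subset_trans BA AS)).
    by rewrite (disjoint_setI0 _) ?set0U // disjoints1.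
  move=> B B'; rewrite !inE => /andP[BA _] /andP[BA' _] e.
  by rewrite -(K B BA) e K.
rewrite -(card_in_imset inj); apply/subset_leq_card/subsetP => _ /imsetP[B + ->].
rewrite !inE => /andP[BA /eqP cardB].
have zB : z \notin B by apply: contra zS => /(subsetP BA)/(subsetP AS).
rewrite cardsU1 zB cardB cliqueU1 ?(clique_sub BA) //; last first.
  by move=> b /(subsetP BA)/zA.
rewrite andbT setDUl; have /eqP-> : B :\: S == set0.
  by rewrite setD_eq0 (subset_trans BA).
rewrite setU0; apply/andP; split; first by apply/eqP; lia.
by apply/eqP/setDidPl; rewrite disjoints1.
Qed.

(** A set Q leaves S at a single point z for at most one z, so the families
    on the left are disjoint. *)
Lemma sum_card_exit {T : finType} (F : {set {set T}}) (S Z : {set T}) :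
  \sum_(z in Z) #|[set Q in F | Q :\: S == [set z]]| <= #|F|.
Proof.
under eq_bigr do rewrite -sum1_card.
under eq_bigr do under eq_bigl do rewrite inE.
rewrite (exchange_big_dep (mem F)) /=; last by move=> x Q _ /andP[].
rewrite -sum1_card; apply: leq_sum => Q QF; under eq_bigl do rewrite QF.
rewrite sum1dep_card; apply/card_le1_eqP => x y.
by rewrite !inE => /andP[_ /eqP->] /andP[_ /eqP/set1_inj].
Qed.

(** With K a maximal clique of light vertices and S its hub, every light
    vertex outside S accounts for 'C(s - 2, r - 1) cliques of its own; the
    subtracted constant bounds the size of S. *)
Lemma light_bound {T : finType} (s r D : nat) (G : sgraph T) :
  1 < r < s -> saturated (complete s) G ->
  (#|[set x | #|star r G x| < D]| - s * (D * r).+1) * 'C(s - 2, r - 1)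
    <= #|cliques r G|.
Proof.
move=> /andP[r1 rs] satG; set L := [set x | _].
have freeG : Defs.free (complete s) G by case/andP: satG.
have [|K maxK _] := @maxset_exists T (fun K => clique G K && (K \subset L)) set0.
  by rewrite sub0set andbT; apply/cliqueP => x y; rewrite inE.
have /maxsetP[/andP[cK KL] maxK'] := maxK.
set S := hub r G K.
have cardS : #|S| <= s * (D * r).+1.
  apply: (@leq_trans (#|K| * (D * r).+1)).
    by apply: card_hub => x /(subsetP KL); rewrite inE => /ltnW.
  by rewrite leq_mul2r ltnW ?orbT ?(clique_card_lt freeG).
have KS : K \subset S by apply: subsetUl.
apply: leq_trans (sum_card_exit (cliques r G) S (L :\: S)).
apply: (@leq_trans (\sum_(z in L :\: S) 'C(s - 2, r - 1))).
  rewrite sum_nat_const leq_mul2r; apply/orP; right.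
  have := subset_leq_card (subsetIr L S); rewrite cardsD; lia.
apply: leq_sum => z /setDP[zL zS].
(* Maximality of K: otherwise z |: K would be a larger light clique. *)
have /existsP[x /andP[xK nGxz]] : [exists x, (x \in K) && ~~ adj G x z].
  apply: contraR zS => /existsPn noxz; apply: (subsetP KS).
  rewrite -(maxK' (z |: K)) ?subsetUr ?setU11 //.
  rewrite subUset sub1set zL KL !andbT; apply: cliqueU1 => // a aK.
  by have := noxz a; rewrite aK negbK adj_sym.
have nxz : x != z by apply: contraNneq zS => <-; apply: (subsetP KS).
have [A [cardA cA xA zA]] := saturated_common_clique satG nxz nGxz.
rewrite -cardA; apply: card_cliques_from => //; first lia.
apply: common_clique_sub_hub xA => //; lia.
Qed.

(** Write t, L and H for the numbers of r-cliques, light and heavy vertices.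
    The threshold D = 3 r C turns the bound on heavy vertices into
    3 C H <= t. Adding three times C L <= t + b C gives 3 C n <= 4 t + 3 b C,
    and the error term is absorbed as soon as n >= 9 b. *)
Lemma saturated_cliques_lower {s r : nat} : 1 < r < s ->
  exists c : nat, forall (T : finType) (G : sgraph T),
    saturated (complete s) G -> c <= #|T| ->
    2 * 'C(s - 2, r - 1) * #|T| <= 3 * #|cliques r G|.
Proof.
move=> rs; set C := 'C(_, _); pose D := 3 * (r * C).
pose b := s * (D * r).+1; exists (9 * b) => T G satG bigT.
have := light_bound s r D G rs satG; have := card_heavy r D G.
rewrite -/C -/b; set L := [set x | _ < _]; set H := [set x | _ <= _].
have cardLH : #|L| + #|H| = #|T|.
  rewrite -(cardsC L); congr (_ + #|pred_of_set _|).
  by apply/setP => x; rewrite !inE ltnNge negbK.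
set t := #|cliques r G| => heavy light.
have {}heavy : 3 * C * #|H| <= t.
  by rewrite -(@leq_pmul2l r); [rewrite /D in heavy; lia | lia].
have : #|L| * C <= t + b * C by rewrite mulnBl in light; lia.
have : 9 * b * C <= #|T| * C by rewrite leq_mul2r bigT orbT.
rewrite -cardLH; lia.
Qed.

(** * The upper bound *)

(** The join of the complete graph on A and the independent set on the
    complement of A: its edges are the pairs that meet A. *)
Definition split_graph {T : finType} (A : {set T}) : sgraph T :=
  graph_of [set e : {set T} | ~~ [disjoint e & A]].

Lemma adj_split_graph {T : finType} (A : {set T}) x y :
  adj (split_graph A) x y = (x != y) && ((x \in A) || (y \in A)).
Proof.
rewrite /adj !inE cards2 disjoints_subset subUset !sub1set !inE negb_and !negbK.
by rewrite andbC; case: (x != y).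
Qed.

Lemma clique_split_graph {T : finType} (A Q : {set T}) :
  clique (split_graph A) Q = (#|Q :\: A| <= 1).
Proof.
apply/cliqueP/card_le1_eqP => [cQ x y | QA x y xQ yQ nxy].
  rewrite !inE => /andP[/negPf xA xQ] /andP[/negPf yA yQ]; apply/eqP.
  apply: contraT => nyx; have := cQ y x yQ xQ nyx.
  by rewrite adj_split_graph xA yA andbF.
rewrite adj_split_graph nxy; apply: contraT; rewrite negb_or => /andP[xA yA].
by case/eqP: nxy; apply/esym/QA; rewrite inE ?xA ?yA.
Qed.

(** A clique exceeds A by at most one vertex, so it has at most s - 1
    vertices; a nonedge xy lies outside A, and joining x to y makes A with x
    and y a clique on s vertices. *)
Lemma split_graph_saturated {T : finType} (s : nat) (A : {set T}) :
  1 < s -> #|A| = s - 2 -> saturated (complete s) (split_graph A).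
Proof.
move=> s1 cardA; apply/andP; split.
  rewrite free_completeE -subset0; apply/subsetP => Q; rewrite !inE.
  rewrite clique_split_graph => /andP[/eqP cardQ].
  have := subset_leq_card (subsetIr Q A); have := cardsID A Q; lia.
apply/forallP => x; apply/forallP => y; apply/implyP => /andP[nxy].
rewrite -/(adj _ x y) adj_split_graph nxy negb_or => /andP[xA yA].
rewrite free_completeE; apply/set0Pn; exists (x |: (y |: A)); rewrite inE.
rewrite !cardsU1 !inE negb_or nxy xA yA cardA; apply/andP; split.
  by apply/eqP; lia.
apply/cliqueP => u v uQ vQ nuv; rewrite adj_add_edge nuv adj_split_graph nuv /=.
move: uQ vQ; rewrite !inE.
case: (u \in A); rewrite ?orbT ?orbF // => uxy.
case: (v \in A); rewrite ?orbT ?orbF // => vxy.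
(* Both u and v lie outside A, so {u, v} is the new edge {x, y}. *)
case/orP: uxy nuv vxy => /eqP->; rewrite [_ == v]eq_sym => /negPf->;
  rewrite ?orbF /= => /eqP->; first exact: eqxx.
by rewrite setUC eqxx.
Qed.

(** An r-clique lies inside A or consists of one outside vertex and r - 1
    vertices of A. *)
Lemma card_cliques_split_graph {T : finType} (r : nat) (A : {set T}) :
  #|cliques r (split_graph A)|
    <= #|~: A| * 'C(#|A|, r - 1) + 'C(#|A|, r).
Proof.
pose N k := [set B : {set T} | B \subset A & #|B| == k].
pose f (p : T * {set T}) := p.1 |: p.2.
apply: (@leq_trans #|f @: setX (~: A) (N (r - 1)) :|: N r|).
  apply/subset_leq_card/subsetP => Q; rewrite !inE clique_split_graph.
  case/andP=> /eqP cardQ; rewrite leq_eqVlt ltnS leqn0 cards_eq0.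
  case/orP=> [/cards1P[z QA]|]; last by rewrite setD_eq0 cardQ eqxx => ->; rewrite orbT.
  have Qz : z |: (Q :&: A) = Q by rewrite -QA setUC setID.
  have zA : z \notin A by have := set11 z; rewrite -QA inE => /andP[].
  apply/orP; left; apply/imsetP; exists (z, Q :&: A); rewrite ?Qz //.
  rewrite !inE /= zA subsetIr /= -(eqn_add2l 1).
  by have := cardsID A Q; rewrite QA cards1 cardQ; lia.
rewrite (leq_trans (leq_card_setU _ _)) // cards_draws leq_add2r.
by rewrite (leq_trans (leq_imset_card _ _)) // cardsX cards_draws.
Qed.

(** * Saturation numbers *)

Lemma leq_sat_upper {s r n : nat} : 1 < s <= n ->
  sat n (complete r) (complete s)
    <= (n - (s - 2)) * 'C(s - 2, r - 1) + 'C(s - 2, r).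
Proof.
case/andP=> s1 sn; have [|A _ cardA] := @subset_of_card _ (s - 2) [set: 'I_n].
  by rewrite cardsT card_ord; lia.
have satA := split_graph_saturated s A s1 cardA.
have exG : exists G : sgraph 'I_n, saturated (complete s) G.
  by exists (split_graph A).
have [_ /(_ _ satA) le_sat] := Defs.satP (complete r) exG.
apply: leq_trans le_sat _; rewrite card_copies_complete.
by have := card_cliques_split_graph r A; rewrite (cardsCs (~: A)) setCK cardA card_ord.
Qed.

Lemma leq_sat_lower {s r : nat} : 1 < r < s ->
  exists c : nat, forall n : nat, c <= n ->
    2 * 'C(s - 2, r - 1) * n <= 3 * sat n (complete r) (complete s).
Proof.
move=> rs; have [c lower] := saturated_cliques_lower rs.
exists (maxn s c) => n; rewrite geq_max => /andP[sn cn].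
have [|A _ cardA] := @subset_of_card _ (s - 2) [set: 'I_n].
  by rewrite cardsT card_ord; lia.
have s1 : 1 < s by lia.
have satA := split_graph_saturated s A s1 cardA.
have exG : exists G : sgraph 'I_n, saturated (complete s) G.
  by exists (split_graph A).
have [[G satG <-] _] := Defs.satP (complete r) exG.
by have := lower _ G satG; rewrite card_ord card_copies_complete => /(_ cn).
Qed.

Local Open Scope ring_scope.

Theorem theorem1p2 (s r : nat) (hr : (3 <= r)%N) (hrs : (r < s)%N) :
  exists n0 : nat, forall n : nat, (n0 <= n)%N ->
    Num.max
      ('C(s - 2, r - 1)%:R / (r - 1)%:R * n%:R - 2 * 'C(s - 2, r - 1)%:R)
      (('C(s - 2, r - 1)%:R + 'C(s - 3, r - 2)%:R) / r%:R * n%:R)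
      <= (sat n (complete r) (complete s))%:R :> rat
    /\ (sat n (complete r) (complete s))%:R
      <= (n%:R - s%:R + 2) * 'C(s - 2, r - 1)%:R + 'C(s - 2, r)%:R :> rat.
Proof.
have rs : (1 < r < s)%N by lia.
have [c lower] := leq_sat_lower rs.
exists (maxn s c) => n; rewrite geq_max => /andP[sn cn].
have {}lower := lower n cn.
have upper : (sat n (complete r) (complete s)
    <= (n - (s - 2)) * 'C(s - 2, r - 1) + 'C(s - 2, r))%N.
  by apply: leq_sat_upper; lia.
have pascal : ('C(s - 3, r - 2) <= 'C(s - 2, r - 1))%N.
  have -> : (s - 2 = (s - 3).+1)%N by lia.
  have -> : (r - 1 = (r - 2).+1)%N by lia.
  by rewrite binS leq_addl.
move: lower upper pascal; set t := sat _ _ _; set C := 'C(_, r - 1)%N.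
set C' := 'C(s - 3, _)%N => lower upper pascal; split; last first.
  have -> : n%:R - s%:R + 2 = (n - (s - 2))%:R :> rat.
    by rewrite !natrB; try lia; ring.
  by rewrite -natrM -natrD ler_nat.
have {}lower : 2 * (C%:R * n%:R) <= 3 * t%:R :> rat.
  by rewrite -!natrM ler_nat mulnA.
have Cn0 : 0 <= C%:R * n%:R :> rat by rewrite -natrM ler0n.
rewrite ge_max; apply/andP; split.
  have C0 : 0 <= C%:R :> rat by rewrite ler0n.
  (* The dropped term 2 C is nonnegative, and 1 / (r - 1) <= 1 / 2. *)
  have bound : C%:R / (r - 1)%:R * n%:R <= (C%:R * n%:R) / 2 :> rat.
    rewrite mulrAC ler_wpM2l // lef_pV2 ?posrE ?ltr0n ?ler_nat; lia.
  lra.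
(* Here (C + C') / r <= 2 C / 3, because C' <= C and 3 <= r. *)
have CC' : (C%:R + C'%:R) * n%:R <= 2 * (C%:R * n%:R) :> rat.
  by rewrite -natrD -!natrM ler_nat mulnA leq_mul2r; apply/orP; right; lia.
rewrite mulrAC ler_pdivrMr ?ltr0n; last lia.
have : 3 * t%:R <= t%:R * r%:R :> rat by rewrite mulrC ler_wpM2l ?ler0n ?ler_nat.
lra.
Qed.
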